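(* Let $d\ge 1$, let $S\subseteq\mathbb{R}^d$ be a discrete set, and let $m,k\ge 1$ be integers. Suppose that the quantitative $S$-Helly number $\mathbb{H}_S(k)$ is finite. Then the quantitative $S$-Tverberg number satisfies \[ \mathbb{T}_S(m,k)\le \mathbb{H}_S(k)\,(m-1)\,k\,d+k . \]
   Context: A set $S\subseteq\mathbb{R}^d$ is discrete if every point $x\in\mathbb{R}^d$ has a neighborhood which intersects $S$ in a finite set. Quantitative $S$-Tverberg number: for positive integers $m,k$, $\mathbb{T}_S(m,k)$ is the smallest positive integer $N$ (if it exists) such that for any $N$ distinct points of $S$ there is a partition of them into $m$ sets $A_1,\dots,A_m$ such that $\bigcap_{i=1}^m\operatorname{conv}(A_i)$ contains at least $k$ points of $S$. If no such integer exists, $\mathbb{T}_S(m,k)=\infty$. Quantitative $S$-Helly number: for a positive integer $k$, $\mathbb{H}_S(k)$ is the smallest positive integer $h$ (if it exists) with the following property: whenever $\mathcal F$ is a nonempty finite family of convex sets in $\mathbb{R}^d$ such that $\bigcap\mathcal G$ contains at least $k$ points of $S$ for every nonempty subfamily $\mathcal G\subseteq\mathcal F$ having at most $h$ members, then $\bigcap\mathcal F$ contains at least $k$ points of $S$. If no such integer exists, $\mathbb{H}_S(k)=\infty$. *)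

(* Defs.v *)
From HB Require Import structures.
From mathcomp Require Import all_boot all_order all_algebra.
From mathcomp Require Import all_classical all_reals all_analysis.

Set Implicit Arguments.
Unset Strict Implicit.
Unset Printing Implicit Defensive.

Import Order.TTheory GRing.Theory Num.Theory.
Import numFieldNormedType.Exports.

Local Open Scope classical_set_scope.
Local Open Scope card_scope.
Local Open Scope ring_scope.

(* [None] stands for the value +oo. *)
Definition least_positive (P : nat -> Prop) : option nat :=
  match pselect (exists n, `[< (0 < n)%N /\ P n >]) with
  | left exP => Some (ex_minn exP)
  | right _ => None
  end.

Lemma least_positive_SomeP (P : nat -> Prop) (n : nat) :
  least_positive P = Some n <->
  [/\ (0 < n)%N, P n & forall i, (0 < i)%N -> P i -> (n <= i)%N].
Proof.
rewrite /least_positive; case: pselect => [exP|nexP].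
  case: ex_minnP => l /asboolP[l0 Pl] lmin; split=> [[<-]|[n0 Pn nmin]].
    by split=> // i i0 Pi; apply: lmin; apply/asboolP.
  congr Some; apply/eqP; rewrite eqn_leq nmin// andbT.
  by apply: lmin; apply/asboolP.
by split=> // -[n0 Pn _]; case: nexP; exists n; apply/asboolP.
Qed.

Lemma least_positive_NoneP (P : nat -> Prop) :
  least_positive P = None <-> forall i, (0 < i)%N -> ~ P i.
Proof.
rewrite /least_positive; case: pselect => [exP|nexP]; split=> //.
  by move=> nP; have [i /asboolP[i0 /(nP i i0)]] := exP.
by move=> _ i i0 Pi; apply: nexP; exists i; apply/asboolP.
Qed.

Section quantitative_helly_tverberg.
Context {R : realType} {d : nat}.
Implicit Types (S X : set 'rV[R]_d) (F G : set (set 'rV[R]_d)).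

Definition discrete_subset S :=
  forall x : 'rV[R]_d, exists2 U, nbhs x U & finite_set (U `&` S).

Definition convex_hull X : set 'rV[R]_d :=
  smallest [set C : set 'rV[R]_d | convex_set C] X.

Definition tverberg_property S (m k N : nat) :=
  forall X, X `<=` S -> X #= `I_N ->
  exists2 A : 'I_m -> set 'rV[R]_d,
    partition [set: 'I_m] A X &
    `I_k #<= (\bigcap_i convex_hull (A i)) `&` S.

Definition tverberg_number S (m k : nat) : option nat :=
  least_positive (tverberg_property S m k).

Definition helly_property S (k h : nat) :=
  forall F, F !=set0 -> finite_set F -> (forall C, F C -> convex_set C) ->
  (forall G, G `<=` F -> G !=set0 -> G #<= `I_h ->
    `I_k #<= (\bigcap_(C in G) C) `&` S) ->
  `I_k #<= (\bigcap_(C in F) C) `&` S.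

Definition helly_number S (k : nat) : option nat :=
  least_positive (helly_property S k).

End quantitative_helly_tverberg.

(* Main.v *)
Require Import Defs.
From mathcomp Require Import all_boot all_order all_algebra.
From mathcomp Require Import all_classical all_reals all_analysis.

Set Implicit Arguments.
Unset Strict Implicit.
Unset Printing Implicit Defensive.

Import Order.TTheory GRing.Theory Num.Theory.
Import numFieldNormedType.Exports.

Local Open Scope classical_set_scope.
Local Open Scope card_scope.
Local Open Scope ring_scope.

(** The proof looks for k points of S that lie so deep among the
    N = h (m - 1) k d + k given ones that a greedy choice of disjoint blocks never
    runs out of room. Put D = (m - 1) k d.

    Deep points. Consider the convex hulls of the subsets that omit at most D of
    the given points. At most h of these subsets omit at most h D points
    altogether, so they have k given points in common; all of these are in S.
    The Helly property then yields p_1, ..., p_k in S that belong to every hull of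
    the family ([helly_deep_points]).

    Blocks. If all p_j are in the hull of B, then Carathéodory's theorem with a
    prescribed vertex x of B ([caratheodory_apex]) provides d points of B for each
    j that, with x, contain p_j in their hull. The vertex x is shared, so that
    k d + 1 points of B contain every p_j in their hull; and k d points suffice if
    some p_j is itself in B, because taking it as x spares its d companions
    ([economical_block]).

    Greedy choice. Depth bears the loss of m - 1 blocks of k d points, and a block
    of k d + 1 points turns out to do no more harm. Suppose that
    p = p_j were outside the hull of the points not yet used, and enlarge the set
    of these points to a set T maximal among those whose hull avoids p. By
    maximality every point x outside T has its mirror image through p in the cone
    at p spanned by T. A block disjoint from T, none of whose points is p, has
    only such points, and p is in its hull; replacing each vertex by its mirror
    image would put p in the hull of T. So T meets every block of k d + 1 points
    ([maximal_avoiding_meets]), and therefore T omits at most k d points of each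
    block, hence at most D points for m - 1 blocks: p would be in the hull of T by
    depth ([hull_complement_blocks]). Thus m - 1 disjoint blocks can be chosen one
    after the other, and the points left over form the last part. *)

(** * Hulls of finite families by barycentric weights *)

Section finite_hull.
Context {R : realFieldType} {V : lmodType R} {I : finType} (a : I -> V).
Implicit Types (B C T : {set I}) (l : I -> R) (p : V).

Definition weights_on B l := (forall i, 0 <= l i) /\ (forall i, i \notin B -> l i = 0).

Definition hull B : set V := [set p | exists l,
  [/\ weights_on B l, \sum_i l i = 1 & \sum_i l i *: a i = p]].

Lemma weights_onS B C l : B \subset C -> weights_on B l -> weights_on C l.
Proof.
move=> BC [l0 lB]; split=> // i iC.
by apply: lB; apply: contra iC => /(fintype.subsetP BC).
Qed.

Lemma hullS B C : B \subset C -> hull B `<=` hull C.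
Proof. by move=> BC p [l [lB l1 lp]]; exists l; split=> //; exact: weights_onS lB. Qed.

Lemma hull_vertex B i : i \in B -> hull B (a i).
Proof.
move=> iB; exists (fun j => (j == i)%:R); split.
- split=> j; first exact: ler0n.
  by case: eqVneq => // ->; rewrite iB.
- by rewrite (bigD1 i)//= eqxx big1 ?addr0// => j /negPf ->.
- rewrite (bigD1 i)//= eqxx scale1r big1 ?addr0// => j /negPf ->.
  exact: scale0r.
Qed.

Lemma hull_neq0 B p : hull B p -> exists i, i \in B.
Proof.
move=> [l [[_ lB] l1 _]]; apply/set0Pn; apply/eqP => B0.
have /esym/eqP := l1; rewrite big1 ?oner_eq0// => i _.
by apply: lB; rewrite B0 inE.
Qed.

Lemma convex_set_hull B : convex_set (hull B).
Proof.
move=> x y t; rewrite !inE => -[l [[l0 lB] l1 lx]] [n [[n0 nB] n1 ny]].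
have t0 : 0 <= t%:num by [].
have t1 : 0 <= 1 - t%:num :> R by rewrite subr_ge0.
exists (fun i => t%:num * l i + (1 - t%:num) * n i); split.
- split=> i; first by rewrite addr_ge0// mulr_ge0.
  by move=> iB; rewrite lB// nB// !mulr0 addr0.
- by rewrite big_split/= -!mulr_sumr l1 n1 !mulr1 addrC subrK.
- rewrite -lx -ny.
  under eq_bigr do rewrite scalerDl -!scalerA.
  by rewrite big_split/= -!scaler_sumr.
Qed.

(** Induction on the size of B: a vertex of positive weight is split off and the
    other weights are rescaled, so that only binary convex combinations occur. *)
Lemma hull_sub_convex B (C : set V) :
  convex_set C -> (forall i, i \in B -> C (a i)) -> hull B `<=` C.
Proof.
move=> Ccvx; have [n] := ubnP #|B|; elim: n B => // n IH B /ltnSE Bn BC p.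
move=> [l [[l0 lB] l1 <-{p}]].
have [i li] : exists i, 0 < l i.
  apply: contrapT => /forallNP l_le0.
  have /esym/eqP := l1; rewrite big1 ?oner_eq0// => j _.
  by apply/eqP; rewrite eq_le l0 andbT leNgt; apply/negP.
have iB : i \in B by apply: contraTT li => /lB ->; rewrite ltxx.
have rest : \sum_(j | j != i) l j = 1 - l i
  by rewrite -l1 [in RHS](bigD1 i)//= [RHS]addrC addKr.
have rest0 : 0 <= 1 - l i by rewrite -rest sumr_ge0.
have [li1|li1] := eqVneq (1 - l i) 0.
  rewrite (bigD1 i)//= [X in _ + X]big1 ?addr0; last first.
    move=> j ji; suff -> : l j = 0 by rewrite scale0r.
    exact: (psumr_eq0P (fun j _ => l0 j) (etrans rest li1)) ji.
  by move/eqP: li1; rewrite subr_eq0 => /eqP <-; rewrite scale1r; exact: BC.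
pose n' j := if j == i then 0 else l j / (1 - l i).
have n'E j : j != i -> n' j = (1 - l i)^-1 * l j by rewrite /n' mulrC => /negPf ->.
have : hull (B :\ i) (\sum_j n' j *: a j).
  exists n'; split=> //.
    split=> j; rewrite /n'; first by case: ifP => // _; rewrite mulr_ge0// invr_ge0.
    by rewrite !inE; case: eqVneq => //= ji jB; rewrite lB// mul0r.
  rewrite (bigD1 i)//= {1}/n' eqxx add0r (eq_bigr _ n'E) -mulr_sumr rest.
  by rewrite mulVf.
move=> /(IH (B :\ i)) Cq.
have {Cq} : C (\sum_j n' j *: a j).
  apply: Cq; first by move: Bn; rewrite (cardsD1 i) iB.
  by move=> j; rewrite inE => /andP[_]; exact: BC.
have li_le1 : l i <= 1 by rewrite -subr_ge0.
move=> Cq.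
have := Ccvx (a i) (\sum_j n' j *: a j) (Itv01 (l0 i) li_le1).
rewrite !inE => /(_ (BC i iB) Cq) /=.
congr C.
rewrite /conv /= [RHS](bigD1 i)//=; congr (_ + _).
rewrite (bigD1 i)//= {1}/n' eqxx scale0r add0r scaler_sumr.
apply: eq_bigr => j ji; rewrite n'E// scalerA mulrA divff// mul1r//.
Qed.

(** Seen from p, membership is the existence of a nontrivial nonnegative linear
    relation. No normalization is left, so that relations can be substituted into
    one another. *)
Lemma hull_relation B p : hull B p <-> exists l,
  [/\ weights_on B l, 0 < \sum_i l i & \sum_i l i *: (a i - p) = 0].
Proof.
have E l : \sum_i l i *: (a i - p) = \sum_i l i *: a i - (\sum_i l i) *: p.
  by under eq_bigr do rewrite scalerBr; rewrite sumrB scaler_suml.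
split=> [[l [lB l1 lp]]|[l [[l0 lB] lgt0]]].
  by exists l; rewrite E l1 lp scale1r subrr; split.
rewrite E => /eqP; rewrite subr_eq0 => /eqP lp.
exists (fun i => (\sum_i l i)^-1 * l i); split.
- by split=> i => [|/lB ->]; rewrite ?mulr0// mulr_ge0// invr_ge0 ltW.
- by rewrite -mulr_sumr mulVf// gt_eqF.
- under eq_bigr do rewrite -scalerA.
  by rewrite -scaler_sumr lp scalerA mulVf ?scale1r// gt_eqF.
Qed.

(** This replaces the usual argument by a separating hyperplane in general
    position. If C and T were disjoint, every vertex of C would be opposite to the
    cone spanned by T at p, and the relation that puts p in the hull of C would
    become, with opposite sign, a relation on T. *)
Lemma maximal_avoiding_meets T C p :
  ~ hull T p -> (forall x, x \notin T -> hull (x |: T) p) ->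
  hull C p -> (forall x, x \in C -> a x <> p) -> C :&: T != finset.set0.
Proof.
move=> Tp Tmax /hull_relation[c [[c0 cC] cgt0 cp]] Cp.
apply/negP => /eqP CT0.
(* each vertex of C is opposite, as seen from p, to a point of the cone of T *)
have opp x : exists t : I -> R, x \in C ->
    [/\ weights_on T t, 0 < \sum_i t i & \sum_i t i *: (a i - p) = - (a x - p)].
  have [xC|] := boolP (x \in C); last by exists (fun=> 0).
  have xT : x \notin T.
    by apply/negP => xT; have := finset.in_set0 x; rewrite -CT0 inE xC xT.
  have [l [[l0 lT] lgt0 lp]] := (hull_relation _ _).1 (Tmax x xT).
  have lx : 0 < l x.
    rewrite lt_neqAle l0 andbT; apply/eqP => lx; apply: Tp; apply/hull_relation.
    exists l; split=> //; split=> // i iT; have [->//|ix] := eqVneq i x.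
    by apply: lT; rewrite !inE negb_or ix.
  pose t i := if i == x then 0 else (l x)^-1 * l i.
  have tE i : i != x -> t i = (l x)^-1 * l i by rewrite /t => /negPf ->.
  have tw : weights_on T t.
    split=> i; rewrite /t; first by case: ifP => // _; rewrite mulr_ge0// invr_ge0.
    case: eqVneq => // ix iT; rewrite (lT i) ?mulr0//.
    by rewrite !finset.inE negb_or ix.
  have ts : \sum_i t i *: (a i - p) = - (a x - p).
    rewrite (bigD1 x)//= {1}/t eqxx scale0r add0r.
    under eq_bigr => i ix do rewrite tE// -scalerA.
    rewrite -scaler_sumr; move: lp; rewrite (bigD1 x)//= => /eqP.
    rewrite addrC addr_eq0 => /eqP ->.
    by rewrite scalerN scalerA mulVf ?scale1r// gt_eqF.
  exists t => _; split=> //; rewrite lt_neqAle sumr_ge0 ?andbT; last by case: tw.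
  apply/eqP => /esym t0; apply: (Cp x xC); apply/eqP; rewrite -subr_eq0 -oppr_eq0 -ts.
  rewrite big1// => i _; have -> : t i = 0; last exact: scale0r.
  by apply: (psumr_eq0P _ t0) => // j _; case: tw.
have [t tP] := choice opp.
apply: Tp; apply/hull_relation.
exists (fun i => \sum_(x in C) c x * t x i); split.
- split=> i => [|iT].
    by apply: sumr_ge0 => x /tP[[t0 _] _ _]; rewrite mulr_ge0.
  by rewrite big1// => x /tP[[_ /(_ i iT) ->] _ _]; rewrite mulr0.
- rewrite exchange_big/=.
  under eq_bigr do rewrite -mulr_sumr.
  have tge x : x \in C -> 0 <= c x * \sum_i t x i.
    by move=> /tP[_ /ltW t0 _]; rewrite mulr_ge0.
  rewrite lt_neqAle sumr_ge0 ?andbT//; apply/eqP => /esym s0.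
  move: cgt0; rewrite big1 ?ltxx// => x _.
  have [xC|/cC//] := boolP (x \in C).
  have /eqP := (psumr_eq0P tge s0) x xC.
  by rewrite mulf_eq0 => /orP[/eqP//|]; case: (tP x xC) => _ /gt_eqF ->.
- under eq_bigr do rewrite scaler_suml.
  rewrite exchange_big/=.
  transitivity (\sum_i - (c i *: (a i - p))); last by rewrite sumrN cp oppr0.
  rewrite [RHS](bigID (mem C))/= [X in _ = _ + X]big1 ?addr0; last first.
    by move=> x /cC ->; rewrite scale0r oppr0.
  apply: eq_bigr => x xC; under eq_bigr do rewrite -scalerA.
  by rewrite -scaler_sumr; case: (tP x xC) => _ _ ->; rewrite scalerN.
Qed.

End finite_hull.

(** * Carathéodory's theorem with a prescribed vertex *)

(** Take T minimal. If it had more than d elements, the vectors [a t - a x] would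
    satisfy a linear relation [mu], of nonnegative sum up to sign. Subtracting a
    growing multiple of [mu] from the weights keeps p fixed and can only increase
    the weight of x, until the weight of some t in T vanishes: then t can be
    dropped. *)
Lemma caratheodory_apex (R : realFieldType) (d : nat) (I : finType)
    (a : I -> 'rV[R]_d) (B : {set I}) (x : I) (p : 'rV[R]_d) :
  hull a B p -> x \in B ->
  exists T : {set I}, [/\ T \subset B, (#|T| <= d)%N & hull a (x |: T) p].
Proof.
move=> Bp xB.
pose Q (T : {set I}) := (T \subset B) && `[< hull a (x |: T) p >].
have QB : Q B.
  rewrite /Q fintype.subxx; apply/asboolP.
  by apply: hullS Bp; exact: finset.subsetUr.
pose T := [arg min_(T < B | Q T) #|T|]%N.
have [TB /asboolP Tp Tmin] : [/\ T \subset B, `[< hull a (x |: T) p >] &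
    forall U, Q U -> (#|T| <= #|U|)%N].
  by rewrite /T; case: fintype.arg_minnP => // U /andP[].
exists T; split=> //; rewrite leqNgt; apply/negP => dT.
have drop_vertex t : t \in T -> hull a (x |: (T :\ t)) p -> False.
  move=> tT tp; have : Q (T :\ t).
    rewrite /Q; apply/andP; split; last exact/asboolP.
    exact: fintype.subset_trans (finset.subsetDl _ _) TB.
  by move/Tmin; rewrite (cardsD1 t) tT add1n ltnn.
have xT : x \notin T.
  apply/negP => xT; apply: (drop_vertex x) => //.
  by rewrite finset.setD1K//; move: Tp; rewrite (finset.setUidPr _)// finset.sub1set.
have [l [[l0 lT] l1 lp]] := Tp.
have [mu [muT muge [t mut] mup]] : exists mu : I -> R,
    [/\ forall i, i \notin T -> mu i = 0, 0 <= \sum_i mu i,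
        exists t, 0 < mu t & \sum_i mu i *: (a i - a x) = 0].
  have [t0 t0T] : exists t0, t0 \in T by apply/card_gt0P/(leq_ltn_trans _ dT).
  pose M := \matrix_(j < #|T|) (a (enum_val j) - a x).
  have [u u0 uM] : exists2 u : 'rV[R]_#|T|, u != 0 & u *m M = 0.
    have kM : kermx M != 0.
      rewrite kermx_eq0 -row_leq_rank -ltnNge.
      exact: leq_ltn_trans (rank_leq_col _) dT.
    exists (nz_row (kermx M)); first by rewrite nz_row_eq0.
    by apply: sub_kermxP; exact: nz_row_sub.
  pose mu i := if i \in T then u 0 (enum_rank_in t0T i) else 0.
  have muE j : mu (enum_val j) = u 0 j by rewrite /mu enum_valP enum_valK_in.
  have muT i : i \notin T -> mu i = 0 by rewrite /mu => /negPf ->.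
  have mup : \sum_i mu i *: (a i - a x) = 0.
    rewrite (bigID (mem T))/= [X in _ + X]big1 ?addr0; last first.
      by move=> i /muT ->; rewrite scale0r.
    rewrite big_enum_val -[RHS]uM mulmx_sum_row; apply: eq_bigr => j _.
    by rewrite muE rowK.
  have [j uj] : exists j, u 0 j != 0.
    apply: contrapT => /forallNP uz; case/eqP: u0; apply/rowP => j.
    by rewrite mxE; apply/eqP/negPn/negP; exact: uz.
  (* up to sign the sum is nonnegative, which forces a positive coefficient *)
  have [nu [nuT nuge [i nui] nup]] : exists nu : I -> R,
      [/\ forall i, i \notin T -> nu i = 0, 0 <= \sum_i nu i,
          exists i, nu i != 0 & \sum_i nu i *: (a i - a x) = 0].
    have [muge|mult] := leP 0 (\sum_i mu i).
      by exists mu; split=> //; exists (enum_val j); rewrite muE.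
    exists (fun i => - mu i); split=> [i /muT ->||| ].
    - exact: oppr0.
    - by rewrite sumrN oppr_ge0 ltW.
    - by exists (enum_val j); rewrite muE oppr_eq0.
    - by under eq_bigr do rewrite scaleNr; rewrite sumrN mup oppr0.
  exists nu; split=> //.
  apply: contrapT => /forallNP nu_le0.
  have nule k : true -> 0 <= - nu k.
    by move=> _; rewrite oppr_ge0 leNgt; apply/negP; exact: nu_le0.
  have nus : \sum_k - nu k = 0.
    by apply/eqP; rewrite eq_le sumr_ge0// sumrN oppr_le0 nuge.
  have /eqP := psumr_eq0P nule nus (i := i) isT.
  by rewrite oppr_eq0 (negPf nui).
have inT i : 0 < mu i -> i \in T by apply: contraTT => /muT ->; rewrite ltxx.
pose s0 := [arg min_(i < t | 0 < mu i) (l i / mu i)]%O.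
have [mus smin] : 0 < mu s0 /\ forall i, 0 < mu i -> l s0 / mu s0 <= l i / mu i.
  by rewrite /s0; case: arg_minP.
(* the first time at which a weight on T vanishes *)
pose s := l s0 / mu s0.
have s_ge0 : 0 <= s by rewrite divr_ge0// ltW.
pose l' i := l i - s * mu i + (if i == x then s * \sum_j mu j else 0).
apply: (drop_vertex s0 (inT _ mus)).
exists l'; split.
- split=> i.
    rewrite addr_ge0//; last by case: ifP => // _; rewrite mulr_ge0.
    rewrite subr_ge0; have [mui|mui] := ltP 0 (mu i).
      by rewrite -ler_pdivlMr// smin.
    by apply: le_trans (l0 i); rewrite mulr_ge0_le0.
  rewrite !finset.inE negb_or => /andP[ix]; rewrite /l' (negPf ix) addr0.
  have [->|is0/= iT] := eqVneq i s0; first by move=> _; rewrite /s divfK ?subrr// gt_eqF.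
  by rewrite muT// mulr0 subr0 lT// !finset.inE negb_or ix.
- rewrite big_split/= sumrB l1 -big_mkcond/= big_pred1_eq -mulr_sumr.
  by rewrite subrK.
- have muax : \sum_i mu i *: a i = (\sum_i mu i) *: a x.
    apply/eqP; rewrite -subr_eq0 scaler_suml -sumrB -[X in _ == X]mup.
    by apply/eqP/eq_bigr => i _; rewrite scalerBr.
  under eq_bigr do rewrite scalerDl scalerBl -scalerA.
  rewrite big_split/= sumrB lp -scaler_sumr muax.
  rewrite [X in _ + X](bigD1 x)//= eqxx [X in _ + (_ + X)]big1 ?addr0; last first.
    by move=> i /negPf ->; rewrite scale0r.
  by rewrite scalerA subrK.
Qed.

(** * Greedy choice of disjoint blocks *)

Lemma card_bigcup_le (I J : finType) (F : J -> {set I}) :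
  (#|(\bigcup_j F j)%SET| <= \sum_j #|F j|)%N.
Proof.
elim/big_ind2: _ => [|U u W w Uu Ww|//]; first by rewrite cards0.
by apply: leq_trans (leq_card_setU _ _) _; exact: leq_add.
Qed.

Section economical_blocks.
Context {R : realFieldType} {d : nat} {I J : finType}.
Variables (a : I -> 'rV[R]_d) (p : J -> 'rV[R]_d).
Implicit Types (B C T : {set I}).

(** The second alternative is the exceptional size [c.+1]: such a block counts as
    one of size [c] because it has a point in every maximal set whose hull avoids
    some [p j]. *)
Definition economical c C : Prop := (forall j, hull a C (p j)) /\
  ((#|C| <= c)%N \/ (#|C| <= c.+1)%N /\ forall j x, x \in C -> a x <> p j).

(** All the Carathéodory simplices share one vertex x. When some [p j] is a point of
    B it is chosen as x, and the simplex of this [p j] reduces to x. *)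
Lemma economical_block B : (0 < d)%N -> (0 < #|J|)%N ->
  (forall j, hull a B (p j)) ->
  exists2 C : {set I}, C \subset B & economical (#|J| * d) C.
Proof.
move=> d0 J0 Bp.
have apex x : x \in B -> exists T : J -> {set I}, forall j,
    [/\ T j \subset B, (#|T j| <= d)%N & hull a (x |: T j) (p j)].
  by move=> xB; have /choice[T TP] j := caratheodory_apex (Bp j) xB; exists T.
have bigS x (T : J -> {set I}) j : x |: T j \subset x |: \bigcup_i T i.
  by apply: finset.setUS; exact: finset.bigcup_sup.
have blockS x (T : J -> {set I}) : x \in B -> (forall j, T j \subset B) ->
    x |: \bigcup_j T j \subset B.
  move=> xB TB; rewrite finset.subUset finset.sub1set xB /=.
  by apply/finset.bigcupsP => j _.
have card_block x (T : J -> {set I}) :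
    (#|x |: \bigcup_j T j| <= (\sum_j #|T j|).+1)%N.
  rewrite cardsU1 -add1n leq_add ?leq_b1//.
  exact: card_bigcup_le.
have [[x [j0 [xB axp]]]|nop] := pselect (exists x j, x \in B /\ a x = p j).
  have [T TP] := apex x xB.
  pose T' j := if j == j0 then finset.set0 else T j.
  exists (x |: \bigcup_j T' j).
    apply: blockS => // j; rewrite /T'; case: ifP => _; first exact: finset.sub0set.
    by case: (TP j).
  split=> [j|]; last left.
    have [->|jj0] := eqVneq j j0.
      by rewrite -axp; apply: hull_vertex; exact: finset.setU11.
    apply: hullS (bigS _ _ j) _ _; rewrite /T' (negPf jj0).
    by case: (TP j).
  apply: leq_trans (card_block _ _) _.
  rewrite (bigD1 j0)//= {1}/T' eqxx cards0 add0n.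
  have /leq_ltn_trans -> // : (\sum_(j | j != j0) #|T' j| <= #|J|.-1 * d)%N.
    rewrite -(cardC1 j0) -sum_nat_const.
    by apply: leq_sum => j jj0; rewrite /T' (negPf jj0); case: (TP j).
  by rewrite ltn_pmul2r// prednK.
have [j0 _] := card_gt0P J0.
have [x xB] := hull_neq0 (Bp j0).
have [T TP] := apex x xB.
have CB : x |: \bigcup_j T j \subset B.
  by apply: blockS => // j; case: (TP j).
exists (x |: \bigcup_j T j) => //; split=> [j|].
  by apply: hullS (bigS _ _ j) _ _; case: (TP j).
right; split.
  apply: leq_trans (card_block _ _) _; rewrite ltnS -sum_nat_const.
  by apply: leq_sum => j _; case: (TP j).
by move=> j y /(fintype.subsetP CB) yB ayp; apply: nop; exists y, j.
Qed.

(** The blocks may have [n * c.+1] points in all, too many for depth to apply to the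
    complement of their union. If its hull avoided [p j], depth would apply to a
    larger set T, maximal among those whose hull avoids [p j], as T contains at
    least one point of each block of size [c.+1]. *)
Lemma hull_complement_blocks (n c D : nat) (F : 'I_n -> {set I}) j :
  (forall B, (#|~: B| <= D)%N -> hull a B (p j)) ->
  (forall i, economical c (F i)) -> (n * c <= D)%N ->
  hull a (~: \bigcup_i F i) (p j).
Proof.
move=> deep Fecon nD; apply: contrapT => rest.
pose Q T := `[< ~ hull a T (p j) >].
have [T /finset.maxsetP[/asboolP Tp Tmax] restT] :
    {T | finset.maxset Q T & ~: (\bigcup_i F i)%SET \subset T}.
  by apply: finset.maxset_exists; exact/asboolP.
apply: (Tp); apply: deep; apply: leq_trans nD.
have Tmax1 x : x \notin T -> hull a (x |: T) (p j).
  move=> xT; apply: contrapT => xTp; move: xT.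
  rewrite -(Tmax (x |: T)) ?finset.setU11//; first exact/asboolP.
  exact: finset.subsetUr.
have small i : (#|F i :\: T| <= c)%N.
  have [Fp [Fc|[Fc Fnp]]] := Fecon i.
    by apply: leq_trans Fc; apply: subset_leq_card; exact: finset.subsetDl.
  rewrite -ltnS; apply: leq_trans Fc; rewrite -(cardsID T (F i)) -add1n leq_add2r.
  by rewrite card_gt0; exact: maximal_avoiding_meets Tp Tmax1 (Fp j) (Fnp j).
have : ~: T \subset (\bigcup_i (F i :\: T))%SET.
  apply/fintype.subsetP => x; rewrite inE => xT.
  have : x \notin ~: (\bigcup_i F i)%SET by apply: contra xT => /(fintype.subsetP restT).
  rewrite inE negbK => /finset.bigcupP[i _ xF].
  by apply/finset.bigcupP; exists i => //; rewrite inE xT.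
move=> /subset_leq_card /leq_trans; apply.
have : (\sum_(i < n) #|F i :\: T| <= n * c)%N.
  by rewrite -[n in leqRHS]card_ord -sum_nat_const; exact: leq_sum.
apply: leq_trans.
exact: card_bigcup_le.
Qed.

End economical_blocks.

Lemma greedy_blocks (R : realFieldType) (d : nat) (I J : finType)
    (a : I -> 'rV[R]_d) (p : J -> 'rV[R]_d) (D n : nat) :
  (0 < d)%N -> (0 < #|J|)%N ->
  (forall j (B : {set I}), (#|~: B| <= D)%N -> hull a B (p j)) ->
  (n * (#|J| * d) <= D)%N ->
  exists F : 'I_n -> {set I}, [/\ forall i, economical a p (#|J| * d) (F i),
    forall i j x, x \in F i -> x \in F j -> i = j &
    forall j, hull a (~: (\bigcup_i F i)%SET) (p j)].
Proof.
move=> d0 J0 deep; elim: n => [_|n IH nD].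
  exists (fun=> finset.set0); split=> [[]//|[]//|j].
  by apply: deep; rewrite big_ord0 finset.setC0 finset.setCT cards0.
have [F [Fecon Fdisj Frest]] := IH (leq_trans (leq_mul (leqnSn n) (leqnn _)) nD).
have [C CF Cecon] := economical_block d0 J0 Frest.
pose G i := if unlift ord_max i is Some i' then F i' else C.
have Gecon i : economical a p (#|J| * d) (G i).
  by rewrite /G; case: unliftP.
exists G; split=> // [i j x|j].
  have CFdisj i' : x \in C -> x \notin F i'.
    move=> /(fintype.subsetP CF); rewrite inE; apply: contra => xF.
    by apply/finset.bigcupP; exists i'.
  rewrite /G; case: unliftP => [i' ->|->]; case: unliftP => [j' ->|-> //].
  - by move=> xi' xj'; rewrite (Fdisj i' j' x).
  - by move=> xi' /(CFdisj i')/negP.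
  - by move=> /(CFdisj j')/negP.
exact: hull_complement_blocks (deep j) Gecon nD.
Qed.

(** * Points of S common to all the hulls *)

Lemma card_ge_ordP (T : pointedType) (k : nat) (A : set T) :
  `I_k #<= A <-> exists2 f : 'I_k -> T, injective f & forall i, A (f i).
Proof.
rewrite (card_le_eql card_II); split=> [/pcard_leP[f]|[f finj fA]].
  exists f => [i j|i]; last exact: (@funS _ _ _ _ f).
  by apply: (@inj _ _ _ f); rewrite inE.
rewrite -(card_le_eql (inj_card_eq (A := setT) (f := f) _)); last first.
  by move=> i j _ _; exact: finj.
by apply: subset_card_le => _ [i _ <-].
Qed.

Lemma card_eq_ord_enum (T : pointedType) (n : nat) (A : set T) :
  A #= `I_n -> exists2 a : 'I_n -> T, injective a & range a = A.
Proof.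
rewrite (card_eqr card_II) card_eq_sym => /pcard_eqP[f].
exists f => [i j|]; first by apply: (@inj _ _ _ f); rewrite inE.
apply/seteqP; split=> [_ [i _ <-]|x Ax]; first exact: (@funS _ _ _ _ f).
have [i _ <-] := @surj _ _ _ _ f x Ax; by exists i.
Qed.

(** Subsets [B i], for [i < h], that omit at most D of the given points each have
    at least [N - h * D >= k] of these points in common. *)
Lemma helly_deep_points (R : realType) (d : nat) (S : set 'rV[R]_d) (k h N D : nat)
    (a : 'I_N -> 'rV[R]_d) :
  helly_property S k h -> injective a -> (forall i, S (a i)) ->
  (h * D + k <= N)%N ->
  exists p : 'I_k -> 'rV[R]_d, [/\ injective p, forall j, S (p j) &
    forall j (B : {set 'I_N}), (#|~: B| <= D)%N -> hull a B (p j)].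
Proof.
move=> helly ainj aS hN.
pose F := hull a @` [set B : {set 'I_N} | (#|~: B| <= D)%N].
suff /card_ge_ordP[p pinj pF] : `I_k #<= (\bigcap_(C in F) C) `&` S.
  exists p; split=> // j; first by case: (pF j).
  by move=> B BD; case: (pF j) => /(_ (hull a B)) + _; apply; exists B.
apply: helly.
- by exists (hull a finset.setT); exists finset.setT => //=; rewrite finset.setCT cards0.
- by apply: finite_image; exact: finite_finset.
- by move=> _ [B _ <-]; exact: convex_set_hull.
move=> G GF [C0 GC0] /pfcard_geP[G0|[g]]; first by move: GC0; rewrite G0.
have /choice[B BP] (i : 'I_h) : exists B : {set 'I_N}, hull a B = g i /\ (#|~: B| <= D)%N.
  have /GF[B BD BE] : G (g i) by apply: (@funS _ _ _ _ g); exact: ltn_ord.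
  by exists B.
pose W := (\bigcap_(i < h) B i)%SET.
have WC : (#|~: W| <= h * D)%N.
  rewrite finset.setC_bigcap -[h in leqRHS]card_ord -sum_nat_const.
  apply: (@leq_trans (\sum_(i < h) #|~: B i|)%N); last first.
    by apply: leq_sum => i _; case: (BP i).
  exact: card_bigcup_le.
have kW : (k <= #|W|)%N.
  rewrite -(leq_add2l (h * D)); apply: (leq_trans hN).
  by rewrite -[leqLHS](card_ord N) -(cardsC W) addnC leq_add2r.
apply/card_ge_ordP; exists (fun i => a (enum_val (widen_ord kW i))).
  by move=> i j /ainj /enum_val_inj /(congr1 val) /= /val_inj.
move=> i; split; last exact: aS.
move=> C /(@surj _ _ _ _ g)[l lh <-].
have [/= <- _] := BP (Ordinal lh); apply: hull_vertex.
by have /finset.bigcapP/(_ (Ordinal lh) isT) := enum_valP (widen_ord kW i).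
Qed.

(** * From Helly to Tverberg *)

Lemma tverberg_of_helly (R : realType) (d : nat) (S : set 'rV[R]_d) (m k h : nat) :
  (0 < d)%N -> (0 < m)%N -> (0 < k)%N -> helly_property S k h ->
  tverberg_property S m k (h * (m - 1) * k * d + k).
Proof.
case: m => // n d0 _ k0 helly X XS; rewrite subn1/= => /card_eq_ord_enum[a ainj aX].
have aS i : S (a i) by apply: XS; rewrite -aX; exists i.
have [|p [pinj pS deep]] :=
    helly_deep_points (D := n * (k * d)) helly ainj aS; first by rewrite !mulnA.
have := @greedy_blocks _ _ _ _ a p (n * (k * d)) n d0; rewrite card_ord.
move=> /(_ k0 deep (leqnn _))[F [Fecon Fdisj Frest]].
pose G (i : 'I_n.+1) := if unlift ord_max i is Some i' then F i' else ~: (\bigcup_i F i)%SET.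
have Gp i j : hull a (G i) (p j).
  rewrite /G; case: unliftP => [i' _|_]; last exact: Frest.
  by case: (Fecon i').
exists (fun i => a @` [set` G i]); last first.
  apply/card_ge_ordP; exists p => // j; split=> // i _ C [Ccvx aC].
  by apply: hull_sub_convex (Gp i j) => // l lG; apply: aC; exists l.
split.
- rewrite -aX; apply/seteqP; split=> [_ [i _ [l _ <-]]|_ [l _ <-]]; first by exists l.
  have [/finset.bigcupP[i _ lF]|lF] := boolP (l \in (\bigcup_i F i)%SET).
    by exists (lift ord_max i) => //; exists l => //=; rewrite /G liftK.
  by exists ord_max => //; exists l => //=; rewrite /G unlift_none inE.
- move=> i j _ _ [_ [[l /= lGi <-] [l' /= lGj /ainj ll']]]; subst l'.
  have notin_rest i' : l \in F i' -> l \in ~: (\bigcup_i F i)%SET -> False.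
    by rewrite inE => lF /finset.bigcupP; apply; exists i'.
  move: lGi lGj; rewrite /G.
  case: unliftP => [i' ->|->]; case: unliftP => [j' ->|-> //].
  - by move=> li' lj'; rewrite (Fdisj i' j' l).
  - by move=> /(notin_rest i').
  - by move=> /[swap] /(notin_rest j').
- move=> i _; have [l lG] := hull_neq0 (Gp i (Ordinal k0)).
  by exists (a l); exists l.
Qed.

Theorem theorem1p4 (R : realType) (d : nat) (hd : (0 < d)%N)
    (S : set 'rV[R]_d) (hS : discrete_subset S)
    (m k : nat) (hm : (0 < m)%N) (hk : (0 < k)%N)
    (h : nat) (hH : helly_number S k = Some h) :
  exists2 N : nat, tverberg_number S m k = Some N
    & (N <= h * (m - 1) * k * d + k)%N.
Proof.
have [_ helly _] := (least_positive_SomeP _ _).1 hH.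
have tver := tverberg_of_helly hd hm hk helly.
have N0 : (0 < h * (m - 1) * k * d + k)%N by rewrite addn_gt0 hk orbT.
case E : (tverberg_number S m k) => [N|].
  by exists N => //; case/least_positive_SomeP: E => _ _; exact.
by have /least_positive_NoneP/(_ _ N0) := E.
Qed.
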